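(* Consider the complex $3\times 3$ matrices $$000=0_3,\quad [-1]^20=\begin{bmatrix}0&1&0\\-1&0&0\\0&0&0\end{bmatrix},\quad 100=\operatorname{diag}(1,0,0),\quad 1^20=\begin{bmatrix}0&-1&0\\1&1&0\\0&0&0\end{bmatrix},\quad [\lambda]^20=\begin{bmatrix}0&1&0\\\lambda&0&0\\0&0&0\end{bmatrix},\quad 110=\operatorname{diag}(1,1,0),$$ $$[-1]^21=\begin{bmatrix}0&1&0\\-1&0&0\\0&0&1\end{bmatrix},\quad 111=I_3,\quad 0^3=\begin{bmatrix}0&1&0\\0&0&1\\0&0&0\end{bmatrix},\quad 1^21=\begin{bmatrix}0&-1&0\\1&1&0\\0&0&1\end{bmatrix},\quad [\mu]^21=\begin{bmatrix}0&1&0\\\mu&0&0\\0&0&1\end{bmatrix},\quad 1^3=\begin{bmatrix}0&0&1\\0&-1&-1\\1&1&0\end{bmatrix},$$ where $\lambda,\mu\in\mathbb C\setminus\{-1,1\}$ and each nonzero $\lambda$ (respectively $\mu$) is determined up to replacement by $\lambda^{-1}$ (respectively $\mu^{-1}$). Every complex $3\times 3$ matrix is congruent to exactly one of these (with these identifications), so they represent the vertices of the closure graph $G_3$ for congruence classes of $3\times 3$ matrices. The arrows of $G_3$ are exactly the following, for all $\lambda,\mu\in\mathbb C\setminus\{-1,1\}$: $$000\to[-1]^20,\quad 000\to 100,\quad [-1]^20\to 1^20,\quad 100\to 1^20,\quad 100\to[\lambda]^20,\quad 100\to 110,$$ $$1^20\to[-1]^21,\quad 1^20\to 0^3,\quad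 [\lambda]^20\to 0^3,\quad 110\to 0^3,\quad 110\to 111,$$ $$[-1]^21\to 1^21,\quad 111\to 1^3,\quad 0^3\to 1^21,\quad 0^3\to[\mu]^21,\quad 0^3\to 1^3.$$ The dimensions of the congruence classes are: $0$ for $000$; $3$ for $[-1]^20$ and $100$; $5$ for $1^20$, $[\lambda]^20$ and $110$; $6$ for $[-1]^21$ and $111$; $7$ for $0^3$; $8$ for $1^21$, $[\mu]^21$ and $1^3$.
   Context: All matrices are over $\mathbb C$. Two $n\times n$ matrices $A,B$ are congruent if $S^TAS=B$ for some nonsingular $S$; the equivalence classes are called congruence classes. The closure graph $G_n$ for congruence classes of $n\times n$ matrices is the directed graph whose vertices are in bijection with the congruence classes of $n\times n$ complex matrices and in which there is a directed path (possibly of length $0$) from $v$ to $w$ if and only if one (equivalently, each) matrix in the congruence class $C_v$ can be transformed to a matrix in $C_w$ by an arbitrarily small perturbation, i.e. $C_v\subseteq\overline{C_w}$. It is the Hasse diagram of the partial order $C_v\preccurlyeq C_w :\Leftrightarrow C_v\subseteq\overline{C_w}$, so its arrows are the covering relations of this order. The dimension of the congruence class of $A\in\mathbb C^{n\times n}$ is $\dim_{\mathbb C}\{X^TA+AX\mid X\in\mathbb C^{n\times n}\}$. The symbols $000$, $[-1]^20$, $1^20$, etc. are merely names of the displayed matrices. *)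

(* Defs.v *)
From HB Require Import structures.
From Stdlib Require Relation_Operators.
From mathcomp Require Import all_boot all_order all_algebra.
From mathcomp Require Import boolp classical_sets reals topology normedtype.
From mathcomp.real_closed Require Import complex.

Set Implicit Arguments.
Unset Strict Implicit.
Unset Printing Implicit Defensive.

Import GRing.Theory Num.Theory.
Import numFieldNormedType.Exports.

Local Open Scope classical_set_scope.
Local Open Scope ring_scope.

(* The complex numbers over R. Typing R[i] as a numClosedFieldType gives it,
   and matrices over it, the norm topology of MathComp-Analysis. *)
Definition complexes (R : realType) : numClosedFieldType := R[i].

Section CongruenceClasses.
Variables (C : numClosedFieldType) (n : nat).
Implicit Types (A B S : 'M[C]_n) (X Y Z : set 'M[C]_n).

Definition congruent A B : Prop :=
  exists2 S, S \in unitmx & S^T *m A *m S = B.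

Definition congr_class A : set 'M[C]_n := [set B | congruent A B].

Definition is_congr_class X : Prop := exists A, X = congr_class A.

Definition class_le X Y : Prop := X `<=` closure Y.

Definition class_lt X Y : Prop := class_le X Y /\ X <> Y.

Definition class_covered X Y : Prop :=
  [/\ is_congr_class X, is_congr_class Y, class_lt X Y &
      ~ exists Z, [/\ is_congr_class Z, class_lt X Z & class_lt Z Y]].

(* E is the arrow relation of the closure graph, whose vertices are the
   congruence classes themselves: E is the covering relation of the closure
   order, and directed paths (possibly of length 0) realize that order. *)
Definition is_closure_graph (E : set 'M[C]_n -> set 'M[C]_n -> Prop) : Prop :=
  (forall X Y, E X Y <-> class_covered X Y) /\
  (forall X Y, is_congr_class X -> is_congr_class Y ->
     (Relation_Operators.clos_refl_trans _ E X Y <-> class_le X Y)).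

Definition congr_tangent_map A S : 'M[C]_n := S^T *m A + A *m S.

Lemma congr_tangent_map_is_linear A : linear (congr_tangent_map A).
Proof.
move=> a S T; rewrite /congr_tangent_map linearP mulmxDl mulmxDr.
by rewrite -scalemxAl -scalemxAr scalerDr addrACA.
Qed.

HB.instance Definition _ A :=
  GRing.isLinear.Build C 'M[C]_n 'M[C]_n *:%R (congr_tangent_map A)
    (congr_tangent_map_is_linear A).

Definition congr_tangent A : {vspace 'M[C]_n} :=
  limg (linfun (congr_tangent_map A)).

Lemma mem_congr_tangent A B :
  B \in congr_tangent A <-> exists S, B = S^T *m A + A *m S.
Proof.
split=> [/memv_imgP [S _ ->]|[S ->]]; first by exists S; rewrite lfunE.
by apply/memv_imgP; exists S; rewrite ?memvf ?lfunE.
Qed.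

Definition congr_dim A : nat := \dim (congr_tangent A).

End CongruenceClasses.

Section Canonical3.
Variable C : numClosedFieldType.

(* C000 = 000, Cm1_0 = [-1]^2 0, C100 = 100, C1sq_0 = 1^2 0,
   Clam_0 l = [l]^2 0, C110 = 110, Cm1_1 = [-1]^2 1, C111 = 111, C0cub = 0^3,
   C1sq_1 = 1^2 1, Cmu_1 m = [m]^2 1, C1cub = 1^3. *)
Inductive canon3 : Type :=
  | C000 | Cm1_0 | C100 | C1sq_0 | Clam_0 of C | C110
  | Cm1_1 | C111 | C0cub | C1sq_1 | Cmu_1 of C | C1cub.

Definition mx3 (rows : seq (seq C)) : 'M[C]_3 :=
  \matrix_(i < 3, j < 3) nth 0 (nth [::] rows i) j.

Definition canon3_mx (v : canon3) : 'M[C]_3 :=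
  match v with
  | C000     => 0
  | Cm1_0    => mx3 [:: [:: 0; 1; 0]; [:: -1; 0; 0]; [:: 0; 0; 0]]
  | C100     => mx3 [:: [:: 1; 0; 0]; [:: 0; 0; 0]; [:: 0; 0; 0]]
  | C1sq_0   => mx3 [:: [:: 0; -1; 0]; [:: 1; 1; 0]; [:: 0; 0; 0]]
  | Clam_0 l => mx3 [:: [:: 0; 1; 0]; [:: l; 0; 0]; [:: 0; 0; 0]]
  | C110     => mx3 [:: [:: 1; 0; 0]; [:: 0; 1; 0]; [:: 0; 0; 0]]
  | Cm1_1    => mx3 [:: [:: 0; 1; 0]; [:: -1; 0; 0]; [:: 0; 0; 1]]
  | C111     => 1%:M
  | C0cub    => mx3 [:: [:: 0; 1; 0]; [:: 0; 0; 1]; [:: 0; 0; 0]]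
  | C1sq_1   => mx3 [:: [:: 0; -1; 0]; [:: 1; 1; 0]; [:: 0; 0; 1]]
  | Cmu_1 m  => mx3 [:: [:: 0; 1; 0]; [:: m; 0; 0]; [:: 0; 0; 1]]
  | C1cub    => mx3 [:: [:: 0; 0; 1]; [:: 0; -1; -1]; [:: 1; 1; 0]]
  end.

Definition canon3_class (v : canon3) : set 'M[C]_3 := congr_class (canon3_mx v).

Definition admissible (v : canon3) : Prop :=
  match v with
  | Clam_0 x | Cmu_1 x => x <> -1 /\ x <> 1
  | _ => True
  end.

Definition same_param (x y : C) : Prop := y = x \/ x <> 0 /\ y = x^-1.

Definition canon3_same (v w : canon3) : Prop :=
  match v, w with
  | Clam_0 l, Clam_0 l' => same_param l l'
  | Cmu_1 m, Cmu_1 m' => same_param m m'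
  | _, _ => v = w
  end.

Inductive arrow3 : canon3 -> canon3 -> Prop :=
  | arrow_000_m10 : arrow3 C000 Cm1_0
  | arrow_000_100 : arrow3 C000 C100
  | arrow_m10_1sq0 : arrow3 Cm1_0 C1sq_0
  | arrow_100_1sq0 : arrow3 C100 C1sq_0
  | arrow_100_lam0 l : arrow3 C100 (Clam_0 l)
  | arrow_100_110 : arrow3 C100 C110
  | arrow_1sq0_m11 : arrow3 C1sq_0 Cm1_1
  | arrow_1sq0_0cub : arrow3 C1sq_0 C0cub
  | arrow_lam0_0cub l : arrow3 (Clam_0 l) C0cub
  | arrow_110_0cub : arrow3 C110 C0cub
  | arrow_110_111 : arrow3 C110 C111
  | arrow_m11_1sq1 : arrow3 Cm1_1 C1sq_1
  | arrow_111_1cub : arrow3 C111 C1cub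
  | arrow_0cub_1sq1 : arrow3 C0cub C1sq_1
  | arrow_0cub_mu1 m : arrow3 C0cub (Cmu_1 m)
  | arrow_0cub_1cub : arrow3 C0cub C1cub.

Definition class_arrow3 (X Y : set 'M[C]_3) : Prop :=
  exists v w, [/\ admissible v, admissible w, arrow3 v w,
                  X = canon3_class v & Y = canon3_class w].

Definition canon3_dim (v : canon3) : nat :=
  match v with
  | C000 => 0
  | Cm1_0 | C100 => 3
  | C1sq_0 | Clam_0 _ | C110 => 5
  | Cm1_1 | C111 => 6
  | C0cub => 7
  | C1sq_1 | Cmu_1 _ | C1cub => 8
  end%N.

End Canonical3.

Arguments C000 {C}.
Arguments Cm1_0 {C}.
Arguments C100 {C}.
Arguments C1sq_0 {C}.
Arguments C110 {C}.
Arguments Cm1_1 {C}.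
Arguments C111 {C}.
Arguments C0cub {C}.
Arguments C1sq_1 {C}.
Arguments C1cub {C}.

(* Main.v *)
From HB Require Import structures.
From Stdlib Require Import Relation_Operators.
Require Import Defs.
From mathcomp Require Import all_boot all_order all_algebra reals.
From mathcomp Require Import boolp classical_sets topology normedtype.
From mathcomp Require Import ring.

Set Implicit Arguments.
Unset Strict Implicit.
Unset Printing Implicit Defensive.

Import GRing.Theory Num.Theory.
Import numFieldNormedType.Exports.

Local Open Scope classical_set_scope.
Local Open Scope ring_scope.

(* Let P = A + A^T. Each congruence class of 3 x 3 matrices has an explicit list
   of equations in A^T, det A, det P, adj A and adj P (closure_eqs) that are
   continuous and invariant under congruence, hence hold on its closure.
   Conversely, a canonical matrix v satisfying the equations of w is w itself or
   satisfies the equations of some u with an arrow u -> w, so that descending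
   along arrows joins v to w. The arrows are degenerations: along a suitable line
   v + tD, for t <> 0, the equations of w hold but those of no u with an arrow
   u -> w do, which by the classification puts v + tD in the class of w.
   As every arrow raises a height function by one, arrows are covering relations
   and distinct canonical matrices are not congruent.
   The classification first brings the skew part of A to 0 or to a fixed rank 2
   block, then normalizes the symmetric part by completing squares. *)

(** * Explicit 3 by 3 matrices *)

Section ExplicitMatrices.
Variable C : numClosedFieldType.
Implicit Types (A B S : 'M[C]_3).

(** Nine named scalars turn matrix identities into polynomial ones, settled entry by entry with
    [ring] or [field]. *)
Definition entries3 (a b c d e f g h i : C) : 'M[C]_3 :=
  mx3 [:: [:: a; b; c]; [:: d; e; f]; [:: g; h; i]].

Lemma entries3_eta A :
  A = entries3 (A 0 0) (A 0 1) (A 0 2%:R) (A 1 0) (A 1 1) (A 1 2%:R)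
               (A 2%:R 0) (A 2%:R 1) (A 2%:R 2%:R).
Proof.
apply/matrixP => i j; rewrite mxE.
case: i => -[|[|[|//]]] Hi; case: j => -[|[|[|//]]] Hj /=;
  by congr (A _ _); apply: val_inj.
Qed.

Lemma entries3P A : exists a b c d e f g h i, A = entries3 a b c d e f g h i.
Proof. by do 9!eexists; exact: entries3_eta. Qed.

Lemma entries3_inj a b c d e f g h i a' b' c' d' e' f' g' h' i' :
  entries3 a b c d e f g h i = entries3 a' b' c' d' e' f' g' h' i' ->
  [/\ [/\ a = a', b = b' & c = c'], [/\ d = d', e = e' & f = f'] &
      [/\ g = g', h = h' & i = i']].
Proof.
move=> /matrixP E.
split; split.
- by have := E 0 0; rewrite !mxE.
- by have := E 0 1; rewrite !mxE.
- by have := E 0 2%:R; rewrite !mxE.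
- by have := E 1 0; rewrite !mxE.
- by have := E 1 1; rewrite !mxE.
- by have := E 1 2%:R; rewrite !mxE.
- by have := E 2%:R 0; rewrite !mxE.
- by have := E 2%:R 1; rewrite !mxE.
- by have := E 2%:R 2%:R; rewrite !mxE.
Qed.

Lemma trmx_entries3 a b c d e f g h i :
  (entries3 a b c d e f g h i)^T = entries3 a d g b e h c f i.
Proof.
by apply/matrixP => -[[|[|[|//]]] ?] [[|[|[|//]]] ?]; rewrite !mxE.
Qed.

Lemma mulmx_entries3 a b c d e f g h i a' b' c' d' e' f' g' h' i' :
  entries3 a b c d e f g h i *m entries3 a' b' c' d' e' f' g' h' i' =
  entries3 (a * a' + b * d' + c * g') (a * b' + b * e' + c * h')
           (a * c' + b * f' + c * i')
           (d * a' + e * d' + f * g') (d * b' + e * e' + f * h')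
           (d * c' + e * f' + f * i')
           (g * a' + h * d' + i * g') (g * b' + h * e' + i * h')
           (g * c' + h * f' + i * i').
Proof.
apply/matrixP => -[[|[|[|//]]] ?] [[|[|[|//]]] ?];
  by rewrite !mxE !big_ord_recr big_ord0 /= !mxE add0r.
Qed.

Lemma addmx_entries3 a b c d e f g h i a' b' c' d' e' f' g' h' i' :
  entries3 a b c d e f g h i + entries3 a' b' c' d' e' f' g' h' i' =
  entries3 (a + a') (b + b') (c + c') (d + d') (e + e') (f + f')
           (g + g') (h + h') (i + i').
Proof.
by apply/matrixP => -[[|[|[|//]]] ?] [[|[|[|//]]] ?]; rewrite !mxE.
Qed.

Lemma oppmx_entries3 a b c d e f g h i :
  - entries3 a b c d e f g h i =
  entries3 (- a) (- b) (- c) (- d) (- e) (- f) (- g) (- h) (- i).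
Proof.
by apply/matrixP => -[[|[|[|//]]] ?] [[|[|[|//]]] ?]; rewrite !mxE.
Qed.

Lemma scalemx_entries3 k a b c d e f g h i :
  k *: entries3 a b c d e f g h i =
  entries3 (k * a) (k * b) (k * c) (k * d) (k * e) (k * f)
           (k * g) (k * h) (k * i).
Proof.
by apply/matrixP => -[[|[|[|//]]] ?] [[|[|[|//]]] ?]; rewrite !mxE.
Qed.

Lemma mx0_entries3 : 0 = entries3 0 0 0 0 0 0 0 0 0.
Proof.
by apply/matrixP => -[[|[|[|//]]] ?] [[|[|[|//]]] ?]; rewrite !mxE.
Qed.

Lemma scalar_entries3 x : x%:M = entries3 x 0 0 0 x 0 0 0 x.
Proof.
by apply/matrixP => -[[|[|[|//]]] ?] [[|[|[|//]]] ?]; rewrite !mxE.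
Qed.

Lemma det_entries3 a b c d e f g h i :
  \det (entries3 a b c d e f g h i) =
  a * (e * i - f * h) - b * (d * i - f * g) + c * (d * h - e * g).
Proof.
rewrite (expand_det_row _ 0) !big_ord_recr big_ord0 /= /cofactor.
rewrite !(expand_det_row _ 0) !big_ord_recr !big_ord0 /= /cofactor.
rewrite !det_mx11 !mxE /=.
ring.
Qed.

Lemma adj_entries3 a b c d e f g h i :
  \adj (entries3 a b c d e f g h i) =
  entries3 (e * i - f * h) (c * h - b * i) (b * f - c * e)
           (f * g - d * i) (a * i - c * g) (c * d - a * f)
           (d * h - e * g) (b * g - a * h) (a * e - b * d).
Proof.
apply/matrixP => -[[|[|[|//]]] ?] [[|[|[|//]]] ?];
  rewrite !mxE /cofactor (expand_det_row _ 0) !big_ord_recr big_ord0 /=;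
  rewrite /cofactor !det_mx11 !mxE /=; ring.
Qed.

Definition simp01 := (@mulr0 C, @mul0r C, @mulr1 C, @mul1r C, @subr0 C,
  @sub0r C, @addr0 C, @add0r C, @oppr0 C).

Definition entries3E := (trmx_entries3, mulmx_entries3, addmx_entries3,
  oppmx_entries3, scalemx_entries3, det_entries3, adj_entries3).

(** A polynomial identity in the entries, hence valid for singular factors too. *)
Lemma adj_mulmx3 A B : \adj (A *m B) = \adj B *m \adj A.
Proof.
have [a [b [c [d [e [f [g [h [i ->]]]]]]]]] := entries3P A.
have [j [k [l [m [n [o [p [q [r ->]]]]]]]]] := entries3P B.
by rewrite !entries3E; congr entries3; ring.
Qed.

End ExplicitMatrices.

(** * Congruence as an equivalence relation *)

Section Congruence.
Variables (C : numClosedFieldType) (n : nat).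
Implicit Types (A B : 'M[C]_n).

Lemma congruent_refl A : congruent A A.
Proof. by exists 1%:M; rewrite ?unitmx1 // trmx1 mul1mx mulmx1. Qed.

Lemma congruent_sym A B : congruent A B -> congruent B A.
Proof.
case=> S uS <-; exists (invmx S); rewrite ?unitmx_inv //.
rewrite trmx_inv !mulmxA mulVmx ?unitmx_tr // mul1mx -mulmxA mulmxV //.
by rewrite mulmx1.
Qed.

Lemma congruent_trans B A D : congruent A B -> congruent B D -> congruent A D.
Proof.
case=> S uS <- [T uT <-]; exists (S *m T); first by rewrite unitmx_mul uS.
by rewrite trmx_mul !mulmxA.
Qed.

Lemma congr_class_eq A B : congruent A B <-> congr_class A = congr_class B.
Proof.
split=> [AB|AB]; last first.
  by change (congr_class A B); rewrite AB; exact: congruent_refl.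
rewrite predeqE => D; split; first exact/congruent_trans/congruent_sym.
exact: congruent_trans.
Qed.

End Congruence.

(* The columns of the matrix S are the new basis vectors. *)
Ltac congruent_by S :=
  exists S;
  [rewrite unitmxE unitfE !entries3E | rewrite !entries3E; congr entries3].

(** * Reduction to canonical forms *)

Section Classification.
Variable C : numClosedFieldType.
Local Notation E := (@entries3 C).

Lemma sqrt_exists (x : C) : exists s, s * s = x.
Proof. by exists (sqrtC x); rewrite -expr2 sqrtCK. Qed.

Lemma inv_sqrt_exists (x : C) : x != 0 -> exists2 s, s != 0 & s * s * x = 1.
Proof.
move=> x0; have [s sE] := sqrt_exists x^-1.
exists s; last by rewrite sE mulVf.
by apply: contraNneq x0 => s0; rewrite -invr_eq0 -sE s0 mulr0.
Qed.

(** Over an algebraically closed field the quadratic form of the block has a nonzero isotropic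
    vector, which becomes the first basis vector. The difference [b - c] changes at most in sign. *)
Lemma congruent_block_isotropic a b c d p : b != c ->
  exists b' c' d', b' != c' /\
    congruent (E a b 0 c d 0 0 0 p) (E 0 b' 0 c' d' 0 0 0 p).
Proof.
move=> bc; have [->|d0] := eqVneq d 0.
  exists c, b, a; split; first by rewrite eq_sym.
  congruent_by (E 0 1 0 1 0 0 0 0 1); try ring.
  by rewrite !simp01 oppr_eq0 oner_eq0.
have [r rE] := sqrt_exists ((b + c) ^+ 2 - 4 * a * d).
(* A root of [a + (b + c) * y + d * y ^+ 2], so that e1 + y e2 is isotropic. *)
pose y := (r - (b + c)) / (2 * d).
exists (b + y * d), (c + y * d), d; split.
  by apply: contraNneq bc => /addIr ->.
congruent_by (E 1 0 0 y 1 0 0 0 1); try ring.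
  by rewrite !simp01 oner_neq0.
transitivity ((r * r - ((b + c) ^+ 2 - 4 * a * d)) / (4 * d)).
  by rewrite /y; field.
by rewrite rE subrr mul0r.
Qed.

(** Starting from an isotropic first vector: if [c = - b], the entry [d] decides between [l = -1]
    and the block of 1^2. Otherwise [b + c] is invertible, [d] can be cleared, and [l] is [c / b],
    or 0 when [b = 0]. *)
Lemma congruent_block a b c d p : b != c ->
  (exists2 l, l <> 1 & congruent (E a b 0 c d 0 0 0 p) (E 0 1 0 l 0 0 0 0 p))
  \/ congruent (E a b 0 c d 0 0 0 p) (E 0 (-1) 0 1 1 0 0 0 p).
Proof.
move=> /(congruent_block_isotropic a d p) [b' [c' [d' [bc' AB]]]].
suff H : forall b c d, b != c ->
    (exists2 l, l <> 1 & congruent (E 0 b 0 c d 0 0 0 p) (E 0 1 0 l 0 0 0 0 p))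
    \/ congruent (E 0 b 0 c d 0 0 0 p) (E 0 (-1) 0 1 1 0 0 0 p).
  case: (H b' c' d' bc') => [[l l1 BD]|BD].
    by left; exists l => //; exact: congruent_trans BD.
  by right; exact: congruent_trans BD.
move=> {b' c' d' bc' AB} {}b {}c {}d bc.
have [cE|bc0] := eqVneq c (- b).
  have b0 : b != 0 by apply: contraNneq bc => b0; rewrite cE b0 oppr0.
  have [->|d0] := eqVneq d 0.
    left; exists (-1).
      move/eqP; rewrite -subr_eq0 => /eqP e.
      have /eqP : (2 : C) = 0.
        by transitivity (- (-1 - 1) : C); [ring|rewrite e oppr0].
      by rewrite pnatr_eq0.
    rewrite cE; congruent_by (E b^-1 0 0 0 1 0 0 0 1); try by field.
    by rewrite !simp01 invr_eq0.
  have [t t0 tE] := inv_sqrt_exists d0.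
  right; rewrite cE; congruent_by (E (- (t * b)^-1) 0 0 0 t 0 0 0 1);
    try by field; rewrite ?b0 ?t0.
    rewrite !simp01.
    by rewrite mulf_neq0 // oppr_eq0 invr_eq0 mulf_neq0.
  by rewrite -tE; ring.
have s0 : b + c != 0 by rewrite addrC addr_eq0.
have [b0|b0] := eqVneq b 0; left.
  have c0 : c != 0 by rewrite eq_sym -b0.
  exists 0; first by apply/eqP; rewrite eq_sym oner_eq0.
  (* Exchanging the two vectors moves the nonzero entry above the diagonal. *)
  rewrite b0; congruent_by (E (- d / c) c^-1 0 1 0 0 0 0 1); try by field.
  by rewrite !simp01 oppr_eq0 invr_eq0.
exists (c / b).
  by apply/eqP; apply: contra bc => /eqP e; rewrite -[c](divfK b0) e mul1r.
congruent_by (E b^-1 (- d / (b + c)) 0 0 1 0 0 0 1);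
  try by field; rewrite ?b0 ?s0.
by rewrite !simp01 invr_eq0.
Qed.

(** The vector e3 spans the kernel of the skew part, is isotropic, and is paired by the symmetric
    part with e2 only. Adding multiples of e3 to e1 and e2 clears [b] and [d]; then 0^3 arises for
    [a = 0] and 1^3 otherwise. *)
Lemma congruent_isotropic_kernel a b c d : b != c ->
  exists2 v, admissible v & congruent (E a b 0 c d 1 0 1 0) (canon3_mx v).
Proof.
move=> bc; pose k := c - b.
have k0 : k != 0 by rewrite subr_eq0 eq_sym.
suff [v va AB] : exists2 v, admissible v &
    congruent (E a 0 0 k 0 1 0 1 0) (canon3_mx v).
  exists v => //; apply: congruent_trans AB.
  congruent_by (E 1 0 0 0 1 0 (- b) (- d / 2) 1); try by rewrite /k; field.
  by rewrite !simp01 oner_eq0.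
have [->|a0] := eqVneq a 0.
  exists C0cub => //.
  congruent_by (E (- k^-1) 0 k^-1 0 1 0 1 0 0); try by field.
  by rewrite !simp01 mulrN1 oppr_eq0 invr_eq0.
have na0 : - a != 0 by rewrite oppr_eq0.
have [s s0 sE] := inv_sqrt_exists na0.
exists C1cub => //.
(* Forced by the entry (3,2) of 1^3, which reads [u * s * k - 1 = 1]. *)
pose u := 2 / (s * k).
have u0 : u != 0 by rewrite mulf_neq0 ?pnatr_eq0 // invr_eq0 mulf_neq0.
congruent_by (E 0 s 0 0 0 u u^-1 (- u^-1) 0);
  try by rewrite /u; field; rewrite ?k0 ?s0.
  by rewrite !simp01 mulrN opprK mulrA mulfK.
have -> : -1 = - (s * s * - a) by rewrite sE.
by ring.
Qed.

(** Again e3 spans the kernel of the skew part. If [p] is nonzero, completing the square splits e3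
    off; if [p], [q1], [q2] all vanish, a block plus 0 remains; otherwise [(q1, q2)] is brought to
    (0, 1). *)
Lemma congruent_normal_skew a b c d q1 q2 p : b != c ->
  exists2 v, admissible v & congruent (E a b q1 c d q2 q1 q2 p) (canon3_mx v).
Proof.
have fromblock p' a' b' c' d' : p' = 0 \/ p' = 1 -> b' != c' ->
    exists2 v, admissible v &
      congruent (E a' b' 0 c' d' 0 0 0 p') (canon3_mx v).
  move=> p01 bc; move: p01 (congruent_block a' d' p' bc) => [->|->].
  - move=> [[l l1 AB]|AB]; last by exists C1sq_0.
    have [l0|l0] := eqVneq l (-1); first by rewrite l0 in AB; exists Cm1_0.
    by exists (Clam_0 l) => //; split=> //; exact/eqP.
  - move=> [[l l1 AB]|AB]; last by exists C1sq_1.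
    have [l0|l0] := eqVneq l (-1); first by rewrite l0 in AB; exists Cm1_1.
    by exists (Cmu_1 l) => //; split=> //; exact/eqP.
have fromq2 a' b' c' d' q1' q2' : q2' != 0 -> b' != c' ->
    exists2 v, admissible v &
      congruent (E a' b' q1' c' d' q2' q1' q2' 0) (canon3_mx v).
  move=> q20 bc; pose x := - (q1' / q2').
  have bc' : b' + x * d' != c' + x * d'.
    by apply: contraNneq bc => /addIr ->.
  have [v va AB] := congruent_isotropic_kernel
    (a' + x * (b' + c') + x ^+ 2 * d') d' bc'.
  exists v => //; apply: congruent_trans AB.
  congruent_by (E 1 0 0 x 1 0 0 0 q2'^-1); try by rewrite /x; field.
  by rewrite !simp01 invr_eq0.
move=> bc; have [->|p0] := eqVneq p 0.
  have [->|q20] := eqVneq q2 0; last exact: fromq2.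
  have [->|q10] := eqVneq q1 0; first by apply: fromblock => //; left.
  have cb : c != b by rewrite eq_sym.
  have [v va AB] := fromq2 d c b a 0 q1 q10 cb.
  exists v => //; apply: congruent_trans AB.
  congruent_by (E 0 1 0 1 0 0 0 0 1); try by ring.
  by rewrite !simp01 oppr_eq0 oner_eq0.
have [t t0 tE] := inv_sqrt_exists p0.
have bc' : b - q1 * q2 / p != c - q1 * q2 / p.
  by apply: contraNneq bc => /addIr ->.
have [v va AB] := fromblock 1 (a - q1 ^+ 2 / p) _ _ (d - q2 ^+ 2 / p)
  (or_intror erefl) bc'.
exists v => //; apply: congruent_trans AB.
congruent_by (E 1 0 0 0 1 0 (- q1 / p) (- q2 / p) t); try by field.
  by rewrite !simp01.
by rewrite -tE; ring.
Qed.

Lemma congruent_diag x y z :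
  exists2 v, admissible v & congruent (E x 0 0 0 y 0 0 0 z) (canon3_mx v).
Proof.
have nrm (w : C) : exists2 s, s != 0 & s * s * w = (w != 0)%:R.
  have [->|w0] := eqVneq w 0; first by exists 1; rewrite ?oner_neq0 ?mulr0.
  exact: inv_sqrt_exists.
have [s s0 sE] := nrm x; have [t t0 tE] := nrm y; have [u u0 uE] := nrm z.
have AB : congruent (E x 0 0 0 y 0 0 0 z)
    (E (x != 0)%:R 0 0 0 (y != 0)%:R 0 0 0 (z != 0)%:R).
  congruent_by (E s 0 0 0 t 0 0 0 u); rewrite -?sE -?tE -?uE; try ring.
  by rewrite !simp01 !mulf_neq0.
have det12 : \det (E 0 1 0 1 0 0 0 0 1) != 0.
  by rewrite det_entries3 !simp01 oppr_eq0 oner_eq0.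
have det23 : \det (E 1 0 0 0 0 1 0 1 0) != 0.
  by rewrite det_entries3 !simp01 oppr_eq0 oner_eq0.
have det13 : \det (E 0 0 1 0 1 0 1 0 0) != 0.
  by rewrite det_entries3 !simp01 oppr_eq0 oner_eq0.
have swap12 b1 b2 b3 :
    congruent (E b1 0 0 0 b2 0 0 0 b3) (E b2 0 0 0 b1 0 0 0 b3).
  by exists (E 0 1 0 1 0 0 0 0 1);
    rewrite ?unitmxE ?unitfE // !entries3E; congr entries3; ring.
have swap23 b1 b2 b3 :
    congruent (E b1 0 0 0 b2 0 0 0 b3) (E b1 0 0 0 b3 0 0 0 b2).
  by exists (E 1 0 0 0 0 1 0 1 0);
    rewrite ?unitmxE ?unitfE // !entries3E; congr entries3; ring.
have swap13 b1 b2 b3 :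
    congruent (E b1 0 0 0 b2 0 0 0 b3) (E b3 0 0 0 b2 0 0 0 b1).
  by exists (E 0 0 1 0 1 0 1 0 0);
    rewrite ?unitmxE ?unitfE // !entries3E; congr entries3; ring.
suff [v va BD] : exists2 v, admissible v &
    congruent (E (x != 0)%:R 0 0 0 (y != 0)%:R 0 0 0 (z != 0)%:R) (canon3_mx v).
  by exists v => //; exact: congruent_trans BD.
case: (x != 0); case: (y != 0); case: (z != 0) => /=.
- by exists C111 => //=; rewrite scalar_entries3; exact: congruent_refl.
- by exists C110 => //=; exact: congruent_refl.
- by exists C110 => //=; exact: swap23.
- by exists C100 => //=; exact: congruent_refl.
- by exists C110 => //=; exact: swap13.
- by exists C100 => //=; exact: swap12.
- by exists C100 => //=; exact: swap13.
- by exists C000 => //=; rewrite mx0_entries3; exact: congruent_refl.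
Qed.

Lemma congruent_sym_block a b d p :
  exists2 v, admissible v & congruent (E a b 0 b d 0 0 0 p) (canon3_mx v).
Proof.
have froma a' b' d' : a' != 0 ->
    exists2 v, admissible v & congruent (E a' b' 0 b' d' 0 0 0 p) (canon3_mx v).
  move=> a0; have [v va AB] := congruent_diag a' (d' - b' ^+ 2 / a') p.
  exists v => //; apply: congruent_trans AB.
  congruent_by (E 1 (- b' / a') 0 0 1 0 0 0 1); try by field.
  by rewrite !simp01 oner_eq0.
have [->|] := eqVneq a 0; last exact: froma.
have [->|b0] := eqVneq b 0; first exact: congruent_diag.
have [->|d0] := eqVneq d 0.
  (* Both diagonal entries of the block vanish, but e1 + e2 has the value [2 * b]. *)
  have b20 : 2 * b != 0 by rewrite mulf_neq0 ?pnatr_eq0.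
  have [v va AB] := froma (2 * b) b 0 b20.
  exists v => //; apply: congruent_trans AB.
  congruent_by (E 1 0 0 1 1 0 0 0 1); try by ring.
  by rewrite !simp01 oner_eq0.
have [v va AB] := froma d b 0 d0.
exists v => //; apply: congruent_trans AB.
congruent_by (E 0 1 0 1 0 0 0 0 1); try by ring.
by rewrite !simp01 oppr_eq0 oner_eq0.
Qed.

Lemma congruent_symmetric a b c d e f :
  exists2 v, admissible v & congruent (E a b c b d e c e f) (canon3_mx v).
Proof.
have fromf a' b' c' d' e' f' : f' != 0 ->
    exists2 v, admissible v &
      congruent (E a' b' c' b' d' e' c' e' f') (canon3_mx v).
  move=> f0; have [v va AB] := congruent_sym_block (a' - c' ^+ 2 / f')
    (b' - c' * e' / f') (d' - e' ^+ 2 / f') f'.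
  exists v => //; apply: congruent_trans AB.
  congruent_by (E 1 0 0 0 1 0 (- c' / f') (- e' / f') 1); try by field.
  by rewrite !simp01 oner_eq0.
have [->|] := eqVneq f 0; last exact: fromf.
have [->|d0] := eqVneq d 0; last first.
  have [v va AB] := fromf a c b 0 e d d0.
  exists v => //; apply: congruent_trans AB.
  congruent_by (E 1 0 0 0 0 1 0 1 0); try by ring.
  by rewrite !simp01 oppr_eq0 oner_eq0.
have [->|e0] := eqVneq e 0; last first.
  have e20 : 2 * e != 0 by rewrite mulf_neq0 ?pnatr_eq0.
  have [v va AB] := fromf a b (c + b) 0 e (2 * e) e20.
  exists v => //; apply: congruent_trans AB.
  congruent_by (E 1 0 0 0 1 1 0 0 1); try by ring.
  by rewrite !simp01 oner_eq0.
have [->|c0] := eqVneq c 0; first exact: congruent_sym_block.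
have [->|a0] := eqVneq a 0; last first.
  have [v va AB] := fromf 0 0 c 0 b a a0.
  exists v => //; apply: congruent_trans AB.
  congruent_by (E 0 0 1 0 1 0 1 0 0); try by ring.
  by rewrite !simp01 oppr_eq0 oner_eq0.
have c20 : 2 * c != 0 by rewrite mulf_neq0 ?pnatr_eq0.
have [v va AB] := fromf 0 b c 0 b (2 * c) c20.
exists v => //; apply: congruent_trans AB.
congruent_by (E 1 0 1 0 1 0 0 0 1); try by ring.
by rewrite !simp01 oner_eq0.
Qed.

Lemma congruent_canon3 (A : 'M[C]_3) :
  exists2 v, admissible v & congruent A (canon3_mx v).
Proof.
have frombd a b c d e f g h i : b != d ->
    exists2 v, admissible v & congruent (E a b c d e f g h i) (canon3_mx v).
  move=> bd; have bd0 : b - d != 0 by rewrite subr_eq0.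
  (* The vector (x, y, 1) spans the kernel of the skew part; it becomes the new e3. *)
  pose x := (f - h) / (b - d); pose y := - (c - g) / (b - d).
  have [v va AB] := congruent_normal_skew a e (c + x * a + y * b)
    (f + x * d + y * e) (i + x * (c + g) + y * (f + h) + x ^+ 2 * a
      + x * y * (b + d) + y ^+ 2 * e) bd.
  exists v => //; apply: congruent_trans AB.
  congruent_by (E 1 0 x 0 1 y 0 0 1); try by rewrite /x /y; field.
  by rewrite !simp01 oner_eq0.
have [a [b [c [d [e [f [g [h [i ->]]]]]]]]] := entries3P A.
have [->|] := eqVneq b d; last exact: frombd.
have [->|cg] := eqVneq c g; last first.
  have [v va AB] := frombd a c d g i h d f e cg.
  exists v => //; apply: congruent_trans AB.
  congruent_by (E 1 0 0 0 0 1 0 1 0); try by ring.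
  by rewrite !simp01 oppr_eq0 oner_eq0.
have [->|fh] := eqVneq f h; first exact: congruent_symmetric.
have hf : h != f by rewrite eq_sym.
have [v va AB] := frombd i h g f e d g d a hf.
exists v => //; apply: congruent_trans AB.
congruent_by (E 0 0 1 0 1 0 1 0 0); try by ring.
by rewrite !simp01 oppr_eq0 oner_eq0.
Qed.

End Classification.

(** * Continuity of determinants, products and adjugates *)

Section MatrixContinuity.
Variable C : numClosedFieldType.

(** A neighbourhood of a matrix contains a product of finitely many neighbourhoods of its entries,
    and filters are stable under finite intersections. *)
Lemma cvg_entries (T : Type) (F : set_system T) (FF : Filter F) m n
    (f : T -> 'M[C]_(m, n)) (M : 'M[C]_(m, n)) :
  (forall i j, f x i j @[x --> F] --> M i j) -> f x @[x --> F] --> M.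
Proof.
move=> fM V [P PM PV].
have : \forall x \near F, forall ij, P ij.1 ij.2 (f x ij.1 ij.2).
  by apply: filter_forall => -[i j]; exact: (fM i j _ (PM i j)).
by apply: filterS => x Px; apply: PV => i j; exact: (Px (i, j)).
Qed.

Lemma continuous_affine (a b : C) : continuous (fun t : C => a + t * b).
Proof.
move=> t; apply: (@cvgD _ _ _ _ (nbhs_filter t)); first exact: cvg_cst.
by apply: cvgM; [exact: cvg_id|exact: cvg_cst].
Qed.

Lemma continuous_det (T : topologicalType) n (f : T -> 'M[C]_n) :
  (forall i j, continuous (fun x => f x i j)) ->
  continuous (fun x => \det (f x)).
Proof.
move=> cf; apply: continuous_big; first exact: add_continuous.
move=> s _ x; apply: cvgM; first exact: cvg_cst.
by apply: continuous_big => [|i _]; [exact: mul_continuous|exact: cf].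
Qed.

Lemma continuous_mulmx (T : topologicalType) m n p
    (f : T -> 'M[C]_(m, n)) (g : T -> 'M[C]_(n, p)) :
  (forall i j, continuous (fun x => f x i j)) ->
  (forall i j, continuous (fun x => g x i j)) ->
  forall i j, continuous (fun x => (f x *m g x) i j).
Proof.
move=> cf cg i j; under eq_fun do rewrite mxE.
apply: continuous_big; first exact: add_continuous.
by move=> k _ A; apply: cvgM; [exact: cf|exact: cg].
Qed.

Lemma continuous_adj (T : topologicalType) n (f : T -> 'M[C]_n) :
  (forall i j, continuous (fun x => f x i j)) ->
  forall i j, continuous (fun x => \adj (f x) i j).
Proof.
move=> cf i j.
under eq_fun do rewrite mxE.
move=> x; apply: cvgM; first exact: cvg_cst.
apply: (@continuous_det _ _ (fun x => row' j (col' i (f x)))) => k l.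
under eq_fun do rewrite !mxE.
exact: cf.
Qed.

Lemma closed_eq_fun (T : topologicalType) (f g : T -> C) :
  continuous f -> continuous g -> closed [set x | f x = g x].
Proof.
move=> cf cg; rewrite [X in closed X](_ : _ = (f \- g) @^-1` [set x | x = 0]).
  apply: preimage_closed; last first.
    exact: accessible_closed_set1 (hausdorff_accessible (@norm_hausdorff _ C)) _.
  by move=> x _; apply: continuousB; [exact: cf|exact: cg].
apply/seteqP; split=> x /=; first by move=> ->; rewrite subrr.
by move=> /eqP; rewrite subr_eq0 => /eqP.
Qed.

Lemma closed_eq_mx (T : topologicalType) m n (f g : T -> 'M[C]_(m, n)) :
  (forall i j, continuous (fun x => f x i j)) ->
  (forall i j, continuous (fun x => g x i j)) -> closed [set x | f x = g x].
Proof.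
move=> cf cg.
rewrite [X in closed X](_ : _ = \bigcap_(ij in [set: 'I_m * 'I_n])
  [set x | f x ij.1 ij.2 = g x ij.1 ij.2]).
  by apply: closed_bigI => ij _; exact: closed_eq_fun.
apply/seteqP; split=> x /=; first by move=> fg ij _ /=; rewrite fg.
by move=> fg; apply/matrixP => i j; exact: (fg (i, j)).
Qed.

End MatrixContinuity.

(** * Closures of congruence classes *)

Section CongruenceClosure.
Variables (C : numClosedFieldType) (n : nat).
Implicit Types (A B : 'M[C]_n) (Y Z : set 'M[C]_n).

Lemma continuous_entry i j : continuous (fun A => A i j).
Proof. exact: coord_continuous. Qed.

(** The map X to S^T X S is continuous and sends the class of [D] into itself. *)
Lemma closure_congr_class A B D :
  congruent A B -> closure (congr_class D) A -> closure (congr_class D) B.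
Proof.
case=> S uS <- clA V.
have cS : (fun X : 'M[C]_n => S^T *m X *m S) X @[X --> A] --> S^T *m A *m S.
  apply: (cvg_entries (nbhs_filter A)) => i j.
  apply: (@continuous_mulmx _ _ _ _ _ (fun X => S^T *m X) (fun=> S)) => k l.
    apply: (@continuous_mulmx _ _ _ _ _ (fun=> S^T) id) => k' l'.
      exact: cst_continuous.
    exact: continuous_entry.
  exact: cst_continuous.
move=> /cS /clA [X [DX VX]]; exists (S^T *m X *m S); split=> //.
by apply: congruent_trans DX _; exists S.
Qed.

Lemma class_le_mem A D :
  class_le (congr_class A) (congr_class D) <-> closure (congr_class D) A.
Proof.
split=> [|clA B AB]; first by apply; exact: congruent_refl.
exact: closure_congr_class AB clA.
Qed.

Lemma class_le_refl Y : class_le Y Y.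
Proof. exact: subset_closure. Qed.

Lemma class_le_trans X Y Z : class_le X Y -> class_le Y Z -> class_le X Z.
Proof.
move=> XY YZ; apply: subset_trans XY _.
by apply: subset_trans (closureS YZ) _; exact: closed_closure.
Qed.

(** Since 0 is not isolated in [C], each neighbourhood of [f 0] contains some [f t] with [t]
    nonzero. *)
Lemma closure_family (f : C -> 'M[C]_n) D :
  (forall i j, continuous (fun t => f t i j)) ->
  (forall t, t != 0 -> congruent D (f t)) -> closure (congr_class D) (f 0).
Proof.
move=> cf fD V V0.
have fc : f t @[t --> 0^'] --> f 0.
  apply: cvg_entries => i j; apply: cvg_trans (cf i j 0).
  by apply: cvg_app; exact: nbhs_dnbhs.
have Vf : \forall t \near 0^', V (f t) := fc V V0.
have [t [Vt t0]] := @filter_ex _ _ (Proper_dnbhs_numFieldType (0 : C)) _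
  (filterI Vf (nbhs_dnbhs_neq (0 : C))).
by exists (f t); split=> //; exact: fD.
Qed.

End CongruenceClosure.

(** * Closed invariant equations for each class *)

Section ClosureEquations.
Variable C : numClosedFieldType.
Implicit Types (A B : 'M[C]_3) (u v w : canon3 C).
Local Notation E := (@entries3 C).

(* Equations of the closure of the class of w. Under A |-> S^T A S the
   determinants of A and of its symmetrization P are multiplied by det(S)^2 and
   their adjugates undergo one and the same linear substitution, so that each
   condition is invariant under congruence. *)
Definition closure_eqs w A : Prop :=
  let P := A + A^T in
  match w with
  | C000 => A = 0
  | Cm1_0 => A^T = - A
  | C100 => A^T = A /\ \adj A = 0
  | C1sq_0 => \det A = 0 /\ \adj P = 0
  | Clam_0 l => [/\ \det A = 0, \det P = 0 &
                    l *: \adj P = (1 + l) ^+ 2 *: \adj A]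
  | C110 => A^T = A /\ \det A = 0
  | Cm1_1 => \adj P = 0
  | C111 => A^T = A
  | C0cub => \det A = 0 /\ \det P = 0
  | C1sq_1 => \det P = 0
  | Cmu_1 m => m * \det P = 2 * (1 + m) ^+ 2 * \det A
  | C1cub => \det P = 8 * \det A
  end.

Lemma closure_eqs_congruent w A B :
  congruent A B -> closure_eqs w A -> closure_eqs w B.
Proof.
case=> S _ <-; have trB : (S^T *m A *m S)^T = S^T *m A^T *m S.
  by rewrite !trmx_mul trmxK mulmxA.
have symB : S^T *m A *m S + S^T *m A^T *m S = S^T *m (A + A^T) *m S.
  by rewrite mulmxDr mulmxDl.
have detB D : \det (S^T *m D *m S) = \det S ^+ 2 * \det D.
  by rewrite !det_mulmx det_tr; ring.
have adjB D : \adj (S^T *m D *m S) = \adj S *m \adj D *m \adj S^T.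
  by rewrite !adj_mulmx3 mulmxA.
case: w => [|||| l ||||||m|] /=; rewrite ?trB ?symB ?detB ?adjB.
- by move=> ->; rewrite mulmx0 mul0mx.
- by move=> ->; rewrite mulmxN mulNmx.
- by move=> [-> ->]; rewrite mulmx0 mul0mx.
- by move=> [-> ->]; rewrite mulr0 mulmx0 mul0mx.
- move=> [-> -> e]; rewrite mulr0; split=> //.
  have lin k D : k *: (\adj S *m D *m \adj S^T) =
    \adj S *m (k *: D) *m \adj S^T by rewrite -scalemxAr -scalemxAl.
  by rewrite !lin e.
- by move=> [-> ->]; rewrite mulr0.
- by move=> ->; rewrite mulmx0 mul0mx.
- by move=> ->.
- by move=> [-> ->]; rewrite mulr0.
- by move=> ->; rewrite mulr0.
- by move=> e; rewrite mulrCA e; ring.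
- by move=> ->; ring.
Qed.

Lemma closed_closure_eqs w : closed (closure_eqs w).
Proof.
have cA i j : continuous (fun A : 'M[C]_3 => A i j) by exact: continuous_entry.
have cT i j : continuous (fun A : 'M[C]_3 => A^T i j).
  by under eq_fun do rewrite mxE; exact: continuous_entry.
have cP i j : continuous (fun A : 'M[C]_3 => (A + A^T) i j).
  under eq_fun do rewrite mxE.
  by move=> A; apply: continuousD; [exact: cA|exact: cT].
have cdA := continuous_det cA; have cdP := continuous_det cP.
have caA := continuous_adj cA; have caP := continuous_adj cP.
have c0 (i j : 'I_3) : continuous (fun A : 'M[C]_3 => (0 : 'M[C]_3) i j).
  exact: cst_continuous.
have cZ k (f : 'M[C]_3 -> 'M[C]_3) i j : continuous (fun A => f A i j) ->
    continuous (fun A => (k *: f A) i j).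
  move=> cf; under eq_fun do rewrite mxE.
  by move=> A; apply: continuousM; [exact: cst_continuous|exact: cf].
have cM k (f : 'M[C]_3 -> C) : continuous f -> continuous (fun A => k * f A).
  by move=> cf A; apply: continuousM; [exact: cst_continuous|exact: cf].
have cst k : continuous (fun _ : 'M[C]_3 => k : C) by exact: cst_continuous.
case: w => [|||| l ||||||m|].
- by apply: closed_eq_mx.
- apply: closed_eq_mx => // i j; under eq_fun do rewrite mxE.
  by move=> A; apply: continuousN; exact: cA.
- by apply: closedI; apply: closed_eq_mx.
- by apply: closedI; [apply: closed_eq_fun|apply: closed_eq_mx].
- rewrite (_ : closure_eqs _ = [set A | \det A = 0] `&`
    [set A | \det (A + A^T) = 0] `&`
    [set A | l *: \adj (A + A^T) = (1 + l) ^+ 2 *: \adj A]); last first.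
    by apply/seteqP; split=> A /= => [[]|[[]]].
  apply: closedI; first by apply: closedI; apply: closed_eq_fun.
  by apply: closed_eq_mx => i j; exact: cZ.
- by apply: closedI; [apply: closed_eq_mx|apply: closed_eq_fun].
- by apply: closed_eq_mx.
- by apply: closed_eq_mx.
- by apply: closedI; apply: closed_eq_fun.
- by apply: closed_eq_fun.
- by apply: closed_eq_fun; exact: cM.
- by apply: closed_eq_fun => //; exact: cM.
Qed.

(** The canonical matrices with 0 and the identity also spelled out, so that the rules [entries3E]
    apply to all of them. *)
Definition canon3_entries v : 'M[C]_3 :=
  match v with
  | C000 => E 0 0 0 0 0 0 0 0 0
  | Cm1_0 => E 0 1 0 (-1) 0 0 0 0 0
  | C100 => E 1 0 0 0 0 0 0 0 0
  | C1sq_0 => E 0 (-1) 0 1 1 0 0 0 0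
  | Clam_0 l => E 0 1 0 l 0 0 0 0 0
  | C110 => E 1 0 0 0 1 0 0 0 0
  | Cm1_1 => E 0 1 0 (-1) 0 0 0 0 1
  | C111 => E 1 0 0 0 1 0 0 0 1
  | C0cub => E 0 1 0 0 0 1 0 0 0
  | C1sq_1 => E 0 (-1) 0 1 1 0 0 0 1
  | Cmu_1 m => E 0 1 0 m 0 0 0 0 1
  | C1cub => E 0 0 1 0 (-1) (-1) 1 1 0
  end.

Lemma canon3E v : canon3_mx v = canon3_entries v.
Proof. by case: v => //=; [exact: mx0_entries3|exact: scalar_entries3]. Qed.

Lemma closure_eqs_canon w : closure_eqs w (canon3_mx w).
Proof.
by rewrite canon3E; case: w => [|||| l ||||||m|] /=;
  rewrite ?(mx0_entries3, entries3E); repeat split; try congr entries3; ring.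
Qed.

(** The solutions of the equations of [w] form a closed set that contains the class of [w], hence
    its closure. *)
Lemma class_le_closure_eqs v w :
  class_le (canon3_class v) (canon3_class w) -> closure_eqs w (canon3_mx v).
Proof.
move/class_le_mem => wv; apply: (@closed_closure_eqs w).
apply: closureS wv => A wA.
exact: closure_eqs_congruent wA (closure_eqs_canon w).
Qed.

End ClosureEquations.

(** * Solving and refuting the equations entrywise *)

Lemma eq_subr0 (V : zmodType) (x y : V) : x = y -> x - y = 0.
Proof. by move=> ->; rewrite subrr. Qed.

Ltac prove_eqs_by tac :=
  rewrite ?canon3E /= ?(mx0_entries3, entries3E); repeat split;
  try congr entries3; tac.

Ltac prove_eqs := prove_eqs_by ltac:(ring).

(* Looks for an equation in the context whose two sides differ by an element
   that is nonzero by hypothesis. *)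
Ltac absurd_eqs_by tac :=
  exfalso; match goal with
  | H : ?a = ?b, N : _ <> _ |- _ => solve [apply: N; first
        [ transitivity (a - b); [tac | exact: (eq_subr0 H)]
        | transitivity (b - a); [tac | exact: (eq_subr0 (esym H))] ]]
  end.

Ltac absurd_eqs := absurd_eqs_by ltac:(ring).

(** Closes an equation whose difference of sides is, up to sign, that of a hypothesis. *)
Ltac eq_from_eqs :=
  apply/eqP; rewrite -subr_eq0; apply/eqP;
  match goal with
  | H : ?a = ?b |- _ => solve [first
        [ transitivity (a - b); [ring | exact: (eq_subr0 H)]
        | transitivity (b - a); [ring | exact: (eq_subr0 (esym H))] ]]
  end.

Ltac split_eqs :=
  rewrite ?canon3E /= ?(mx0_entries3, entries3E) ?simp01;
  repeat match goal with
  | |- _ /\ _ -> _ => case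
  | |- and3 _ _ _ -> _ => case
  | |- entries3 _ _ _ _ _ _ _ _ _ = _ -> _ => move=> /entries3_inj
  | |- ?a = ?a -> _ => move=> _
  | |- _ = _ -> _ => move=> ?
  end.

(** The nonzero factors that occur when the equations are compared; [absurd_eqs] searches the
    context for them. *)
Lemma admissible_param (C : numClosedFieldType) (l : C) : l <> -1 -> l <> 1 ->
  [/\ 1 + l <> 0, (1 + l) ^+ 2 <> 0, 2 * (1 + l) ^+ 2 <> 0,
      l - 1 <> 0 & (l - 1) ^+ 2 <> 0 /\ 2 * (l - 1) ^+ 2 <> 0].
Proof.
move=> /eqP lm1 /eqP l1.
have p0 : 1 + l != 0 by rewrite addrC addr_eq0.
have m0 : l - 1 != 0 by rewrite subr_eq0.
split; try apply/eqP => //.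
- by rewrite expf_neq0.
- by rewrite mulf_neq0 ?expf_neq0 ?pnatr_eq0.
- by split; apply/eqP; rewrite ?expf_neq0 // mulf_neq0 ?expf_neq0 ?pnatr_eq0.
Qed.

(** Has no effect for a canonical form without parameter, where [admissible] is [True]. *)
Ltac use_admissible h :=
  first [case: (h) => /admissible_param /[apply] -[? ? ? ? [? ?]] | idtac].

(** * Descent along one arrow *)

Section ClosureOrder.
Variable C : numClosedFieldType.
Implicit Types (A B : 'M[C]_3) (u v w : canon3 C).

(** These inequalities stand in the context for [absurd_eqs]. *)
Let n1 : (1 : C) <> 0. Proof. by apply/eqP; exact: oner_neq0. Qed.
Let n2 : (2 : C) <> 0. Proof. by apply/eqP; rewrite pnatr_eq0. Qed.
Let n4 : (4 : C) <> 0. Proof. by apply/eqP; rewrite pnatr_eq0. Qed.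
Let n8 : (8 : C) <> 0. Proof. by apply/eqP; rewrite pnatr_eq0. Qed.

(** Where defined, x / (1 + x)^2 is invariant under inversion of x; the hypothesis compares its
    values at [l] and [l'], and the difference of its sides factors. *)
Lemma same_param_eq (l l' : C) :
  l * (1 + l') ^+ 2 = (1 + l) ^+ 2 * l' -> same_param l' l.
Proof.
move=> e; have : (l - l') * (1 - l' * l) = 0.
  transitivity (l * (1 + l') ^+ 2 - (1 + l) ^+ 2 * l'); first by ring.
  by rewrite e subrr.
move/eqP; rewrite mulf_eq0 !subr_eq0 => /orP[/eqP ->|/eqP ll]; first by left.
have l'0 : l' != 0.
  by apply/eqP => l'0; move: ll; rewrite l'0 mul0r => /eqP; rewrite oner_eq0.
by right; split; [exact/eqP|rewrite -[RHS]mulr1 ll mulKf].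
Qed.

Ltac step_to U :=
  right; exists U; split=> //; [solve [constructor] | prove_eqs].

(** A check over all pairs of canonical forms: they agree, an equation fails, or some predecessor of
    [w] has equations that [v] satisfies. *)
Lemma closure_eqs_step w v : admissible w -> admissible v ->
  closure_eqs w (canon3_mx v) ->
  canon3_same v w \/
  exists u, [/\ admissible u, arrow3 u w & closure_eqs u (canon3_mx v)].
Proof.
move=> wa va.
case: w wa => [|||| l ||||||m|] wa; use_admissible wa;
  case: v va => [|||| l' ||||||m'|] va; use_admissible va; split_eqs;
  try first [by left | absurd_eqs | step_to (@C000 C) | step_to (@Cm1_0 C)
    | step_to (@C100 C) | step_to (@C1sq_0 C) | step_to (@C110 C)
    | step_to (@Cm1_1 C) | step_to (@C111 C) | step_to (@C0cub C)].
- by left; apply: same_param_eq; eq_from_eqs.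
(* Here [v] is 0^3 and [w] is [l]^2 0: one entry gives [l = 0], after which another reads
   [1 = 0]. *)
- have l0 : l = 0 by eq_from_eqs.
  by subst l; absurd_eqs.
- step_to (Clam_0 l').
(* The determinants give the equation of [same_param_eq] multiplied by 2. *)
- by left; apply: same_param_eq; apply: (mulfI (introN eqP n2)); eq_from_eqs.
Qed.

End ClosureOrder.

(** * Degenerations along lines *)

Section ClosureGraph.
Variable C : numClosedFieldType.
Implicit Types (A B D : 'M[C]_3) (u v w : canon3 C).
Local Notation E := (@entries3 C).

Lemma canon3_same_congruent v w :
  canon3_same v w -> congruent (canon3_mx v) (canon3_mx w).
Proof.
have swap (l p : C) : l <> 0 ->
    congruent (E 0 1 0 l 0 0 0 0 p) (E 0 1 0 l^-1 0 0 0 0 p).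
  move=> /eqP l0; congruent_by (E 0 1 0 l^-1 0 0 0 0 1); try by field.
  by rewrite ?(mulr0, mul0r, mulr1, subr0, sub0r, addr0) oppr_eq0 mul1r invr_eq0.
case: v => [|||| l ||||||m|]; case: w => [|||| l' ||||||m'|] //=;
  try (by move=> _; exact: congruent_refl); case=> [->|[? ->]];
  [exact: congruent_refl|exact: swap|exact: congruent_refl|exact: swap].
Qed.

(** Recognizes the class of [B] without a change of basis: the canonical form of [B] satisfies the
    equations of [w] but of no predecessor, so [closure_eqs_step] identifies it with [w]. *)
Lemma congruent_of_closure_eqs w B : admissible w -> closure_eqs w B ->
  (forall u, admissible u -> arrow3 u w -> ~ closure_eqs u B) ->
  congruent (canon3_mx w) B.
Proof.
move=> wa wB notB; have [v va Bv] := congruent_canon3 B.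
have vB := congruent_sym Bv.
have [|[u [ua uw uv]]] := closure_eqs_step wa va (closure_eqs_congruent Bv wB).
  move=> /canon3_same_congruent vw.
  exact: congruent_sym (congruent_trans Bv vw).
by case: (notB u ua uw); exact: closure_eqs_congruent uv.
Qed.

Lemma class_le_degeneration v w D : admissible w ->
  (forall t, t != 0 -> closure_eqs w (canon3_entries v + t *: D)) ->
  (forall t u, t != 0 -> admissible u -> arrow3 u w ->
     ~ closure_eqs u (canon3_entries v + t *: D)) ->
  class_le (canon3_class v) (canon3_class w).
Proof.
move=> wa wD notD; apply/class_le_mem.
have -> : canon3_mx v = canon3_entries v + 0 *: D.
  by rewrite scale0r addr0 canon3E.
apply: (@closure_family _ _ (fun t => canon3_entries v + t *: D)) => [i j|t t0].
  under eq_fun do rewrite !mxE.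
  exact: continuous_affine.
apply: congruent_of_closure_eqs => // [|u]; first exact: wD.
exact: notD.
Qed.

Lemma nonzero_multiples (t : C) : t != 0 ->
  [/\ (1 : C) <> 0, (2 : C) <> 0, t <> 0, t ^+ 2 <> 0 &
      [/\ 2 * t <> 0, 4 * t <> 0 & (4 : C) <> 0]].
Proof.
move=> t0; split; [..|split]; apply/eqP;
  by rewrite ?mulf_neq0 ?expf_neq0 ?pnatr_eq0 ?oner_neq0.
Qed.

Ltac degenerate_along_by D tac :=
  apply: (@class_le_degeneration _ _ D) => //;
  [by move=> t t0; prove_eqs_by tac
  |move=> t u /nonzero_multiples[n1 n2 nt nt2 [n2t n4t n4]] ua uw;
   inversion uw; subst; rewrite /not; split_eqs; try absurd_eqs_by tac].

Ltac degenerate_along D := degenerate_along_by D ltac:(ring).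

(** Each [D] below is the direction of a line through [v] whose points with [t] nonzero lie in the
    class of [w]. *)
Lemma arrow3_class_le v w : admissible v -> admissible w -> arrow3 v w ->
  class_le (canon3_class v) (canon3_class w).
Proof.
move=> va wa vw; case: vw va wa => [||||l||||l||||||m|] va wa.
- degenerate_along (E 0 1 0 (-1) 0 0 0 0 0).
- degenerate_along (E 1 0 0 0 0 0 0 0 0).
- degenerate_along (E 0 0 0 0 1 0 0 0 0).
- degenerate_along (E 0 1 0 (-1) 0 0 0 0 0).
- degenerate_along (E 0 1 0 l 0 0 0 0 0).
  (* Excludes the predecessor 100: the line is not symmetric, as [t] and [t * l] differ. *)
  case: wa => _ /eqP l1; have ntl : t * (l - 1) <> 0.
    by apply/eqP; rewrite mulf_neq0 ?subr_eq0 //; exact/eqP.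
  absurd_eqs.
- degenerate_along (E 0 0 0 0 1 0 0 0 0).
- degenerate_along (E 0 0 1 0 0 0 (-1) 0 0).
- degenerate_along (E 0 0 0 0 0 0 0 1 0).
  use_admissible ua; absurd_eqs.
- degenerate_along (E 0 0 0 0 0 1 0 0 0).
  (* Excludes [l0]^2 0: one adjugate entry forces [l0 = 0], another is then contradictory. *)
  have l00 : l0 = 0 by apply: (mulIf (introN eqP nt2)); eq_from_eqs.
  by subst l0; absurd_eqs.
(* A skew direction keeps P constant, so det P stays 0; with [i * i = -1] also det A = t^2 (1 + i^2)
   vanishes. *)
- have [i ii] := sqrt_exists (-1 : C).
  degenerate_along_by (E 0 0 i 0 0 (-1) (- i) 1 0) ltac:(ring: ii).
  use_admissible ua; have ntl : t ^+ 2 * (1 + l) ^+ 2 <> 0.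
    by apply/eqP; rewrite mulf_neq0 //; exact/eqP.
  absurd_eqs.
- degenerate_along (E 0 0 0 0 0 0 0 0 1).
- degenerate_along (E 0 0 0 0 1 0 0 0 0).
(* For the same direction at the identity, det P = 8 and det A = 1 + t^2 (1 + i^2) = 1. *)
- have [i ii] := sqrt_exists (-1 : C).
  degenerate_along_by (E 0 0 i 0 0 (-1) (- i) 1 0) ltac:(ring: ii).
- degenerate_along (E 1 0 0 0 0 0 1 0 0).
(* The corner is chosen so that det A = t m and det P = 2 t (1 + m)^2; the latter is nonzero even
   for [m = 0]. *)
- degenerate_along (E (m - (1 + m) ^+ 2) 0 0 0 0 0 m 0 0).
  use_admissible wa; have ntm : t * (2 * (1 + m) ^+ 2) <> 0.
    by apply/eqP; rewrite mulf_neq0 //; exact/eqP.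
  absurd_eqs.
(* The preceding direction at [m = 1]. *)
- degenerate_along (E (-3) 0 0 0 0 0 1 0 0).
Qed.

End ClosureGraph.

(** * Heights, paths and covering relations *)

Section Covering.
Variable C : numClosedFieldType.
Implicit Types (A B : 'M[C]_3) (u v w : canon3 C) (X Y Z : set 'M[C]_3).

(** A rank function for the arrows. It is coarser than dimension: 0^3 has the height of [-1]^2 1 and
    111. *)
Definition canon3_height v : nat :=
  match v with
  | C000 => 0
  | Cm1_0 | C100 => 1
  | C1sq_0 | Clam_0 _ | C110 => 2
  | Cm1_1 | C111 | C0cub => 3
  | C1sq_1 | Cmu_1 _ | C1cub => 4
  end.

Lemma arrow3_height v w :
  arrow3 v w -> canon3_height w = (canon3_height v).+1.
Proof. by case. Qed.

Lemma canon3_same_height v w :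
  canon3_same v w -> canon3_height v = canon3_height w.
Proof. by case: v => [|||| l ||||||m|]; case: w => [|||| l' ||||||m'|]. Qed.

Lemma canon3_same_class v w :
  canon3_same v w -> canon3_class v = canon3_class w.
Proof. by move/canon3_same_congruent/congr_class_eq. Qed.

(** Induction on the height of [w], replacing [w] by the predecessor that [closure_eqs_step]
    provides. *)
Lemma closure_eqs_height v w : admissible v -> admissible w ->
  closure_eqs w (canon3_mx v) ->
  canon3_same v w \/ (canon3_height v < canon3_height w)%N.
Proof.
move=> va; have [n] := ubnP (canon3_height w).
elim: n w => // n IH w lt_wn wa wv.
have [|[u [ua uw uv]]] := closure_eqs_step wa va wv; first by left.
have hw := arrow3_height uw; rewrite hw in lt_wn *.
right; have [/canon3_same_height -> //|] := IH u lt_wn ua uv.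
by move=> lt_vu; apply: ltn_trans lt_vu _.
Qed.

Lemma class_le_height v w : admissible v -> admissible w ->
  class_le (canon3_class v) (canon3_class w) ->
  canon3_same v w \/ (canon3_height v < canon3_height w)%N.
Proof. by move=> va wa /class_le_closure_eqs; exact: closure_eqs_height. Qed.

(** Equal classes are comparable both ways, and two opposite strict inequalities of heights are
    impossible. *)
Lemma canon3_class_inj v w : admissible v -> admissible w ->
  canon3_class v = canon3_class w -> canon3_same v w.
Proof.
move=> va wa vw.
have [//|lt_vw] : canon3_same v w \/ (canon3_height v < canon3_height w)%N.
  by apply: class_le_height => //; rewrite vw; exact: class_le_refl.
have [/canon3_same_height wv|lt_wv] :
    canon3_same w v \/ (canon3_height w < canon3_height v)%N.
- by apply: class_le_height => //; rewrite vw; exact: class_le_refl.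
- by rewrite wv ltnn in lt_vw.
- by have := ltn_trans lt_vw lt_wv; rewrite ltnn.
Qed.

Lemma closure_eqs_path v w : admissible v -> admissible w ->
  closure_eqs w (canon3_mx v) ->
  clos_refl_trans _ (@class_arrow3 C) (canon3_class v) (canon3_class w).
Proof.
move=> va; have [n] := ubnP (canon3_height w).
elim: n w => // n IH w lt_wn wa wv.
have [/canon3_same_class ->|[u [ua uw uv]]] := closure_eqs_step wa va wv.
  exact: rt_refl.
rewrite (arrow3_height uw) in lt_wn.
by apply: rt_trans (IH u lt_wn ua uv) _; apply: rt_step; exists u, w.
Qed.

Lemma is_congr_class_canon3 X :
  is_congr_class X -> exists2 v, admissible v & X = canon3_class v.
Proof.
move=> [A ->]; have [v va /congr_class_eq Av] := congruent_canon3 A.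
by exists v.
Qed.

Lemma arrow3_class_lt v w : admissible v -> admissible w -> arrow3 v w ->
  class_lt (canon3_class v) (canon3_class w).
Proof.
move=> va wa vw; split; first exact: arrow3_class_le.
move=> /(canon3_class_inj va wa) /canon3_same_height.
by rewrite (arrow3_height vw) => /n_Sn.
Qed.

Lemma class_lt_height v w : admissible v -> admissible w ->
  class_lt (canon3_class v) (canon3_class w) ->
  (canon3_height v < canon3_height w)%N.
Proof.
move=> va wa [/(class_le_height va wa)[vw|//] nvw].
by case: nvw; exact: canon3_same_class.
Qed.

Lemma class_arrow3P X Y : class_arrow3 X Y <-> class_covered X Y.
Proof.
split=> [[v [w [va wa vw -> ->]]]|].
  split;
    [by exists (canon3_mx v)|by exists (canon3_mx w)|exact: arrow3_class_lt|].
  move=> [Z [/is_congr_class_canon3[u ua ->]]].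
  move=> /(class_lt_height va ua) lt_vu /(class_lt_height ua wa).
  (* A class strictly between would have a height strictly between two consecutive integers. *)
  by rewrite (arrow3_height vw) ltnS leqNgt lt_vu.
move=> [/is_congr_class_canon3[v va ->] /is_congr_class_canon3[w wa ->]].
move=> [le_vw neq_vw] nZ.
(* The last arrow [u] to [w] of a descent is the covering itself, since otherwise [u] would lie
   strictly between. *)
have [/canon3_same_class //|[u [ua uw uv]]] :=
  closure_eqs_step wa va (class_le_closure_eqs le_vw).
have [vu|neq_vu] := pselect (canon3_class v = canon3_class u).
  by exists u, w.
case: nZ; exists (canon3_class u); split; first by exists (canon3_mx u).
  split=> //; have : clos_refl_trans _ (@class_arrow3 C) (canon3_class v)
      (canon3_class u) by exact: closure_eqs_path.
  elim=> [_ _ [v' [w' [va' wa' vw' -> ->]]]|?|? Z ? _ XZ _ ZY].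
  - exact: arrow3_class_le.
  - exact: class_le_refl.
  - exact: class_le_trans XZ ZY.
exact: arrow3_class_lt.
Qed.

Lemma class_arrow3_pathP X Y : is_congr_class X -> is_congr_class Y ->
  clos_refl_trans _ (@class_arrow3 C) X Y <-> class_le X Y.
Proof.
move=> Xc Yc; split=> [XY|].
  elim: XY {Xc Yc} => [_ _ [v [w [va wa vw -> ->]]]|?|? Z ? _ XZ _ ZY].
  - exact: arrow3_class_le.
  - exact: class_le_refl.
  - exact: class_le_trans XZ ZY.
have [v va ->] := is_congr_class_canon3 Xc.
have [w wa ->] := is_congr_class_canon3 Yc.
by move/class_le_closure_eqs; exact: closure_eqs_path.
Qed.

End Covering.

(** * Dimensions of tangent spaces *)

Section TangentDimension.
Variable C : numClosedFieldType.
Local Notation E := (@entries3 C).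

(** The bijection X to S^T X S carries the tangent space at [A] onto that at [B], the parameter
    being conjugated by [S]. *)
Lemma congr_dim_congruent n (A B : 'M[C]_n) :
  congruent A B -> congr_dim A = congr_dim B.
Proof.
case=> S uS SB; pose h := linfun (mulmxr S \o mulmx S^T : 'M[C]_n -> 'M[C]_n).
have hE X : h X = S^T *m X *m S by rewrite lfunE.
have uST : S^T \in unitmx by rewrite unitmx_tr.
rewrite /congr_dim; suff -> : congr_tangent B = (h @: congr_tangent A)%VS.
  rewrite (@limg_dim_eq _ _ _ h) //; apply/eqP; rewrite -subv0; apply/subvP => X.
  rewrite memv_cap memv_ker hE memv0 => /andP[_ /eqP hX].
  by rewrite -[X](mulKmx uST) -[S^T *m X](mulmxK uS) hX mul0mx mulmx0.
have tgt X :
    h (congr_tangent_map A (S *m X *m invmx S)) = congr_tangent_map B X.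
  rewrite hE /congr_tangent_map -SB !trmx_mul trmx_inv mulmxDr mulmxDl.
  rewrite !mulmxA mulmxV // mul1mx; congr (_ + _).
  by rewrite mulmxKV.
apply/vspaceP => Y; apply/idP/idP.
  move=> /memv_imgP[X _ ->]; rewrite lfunE /= -tgt memv_img //.
  by apply/memv_imgP; exists (S *m X *m invmx S); rewrite ?memvf ?lfunE.
move=> /memv_imgP[_ /memv_imgP[X _ ->] ->].
apply/memv_imgP; exists (invmx S *m X *m S); first exact: memvf.
rewrite [RHS]lfunE /= -tgt; congr (h _); rewrite lfunE /=; congr congr_tangent_map.
by rewrite !mulmxA mulmxV // mul1mx mulmxK.
Qed.

(** The two conditions say that reading the entries at the positions [s] is injective and surjective
    on the tangent space, so [s] indexes coordinates on it. *)
Lemma congr_dim_coordinates n (A : 'M[C]_n) (s : seq ('I_n * 'I_n)) : uniq s ->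
  (forall X, all (fun ij => congr_tangent_map A X ij.1 ij.2 == 0) s ->
     congr_tangent_map A X = 0) ->
  (forall Y : 'M[C]_n, exists X,
     [seq congr_tangent_map A X ij.1 ij.2 | ij <- s]
     = [seq Y ij.1 ij.2 | ij <- s]) ->
  congr_dim A = size s.
Proof.
move=> us inj surj.
pose c k := tnth (in_tuple s) k.
pose p (X : 'M[C]_n) : 'rV[C]_(size s) := \row_k X (c k).1 (c k).2.
have pL : linear p by move=> a X Y; apply/rowP => k; rewrite !mxE.
pose pl := GRing.isLinear.Build _ _ _ _ p pL.
pose pL' : {linear 'M[C]_n -> 'rV[C]_(size s)} := HB.pack p pl.
pose q := linfun pL'.
have qE X : q X = p X by rewrite lfunE.
have -> : size s = \dim (fullv : {vspace 'rV[C]_(size s)}).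
  by rewrite dimvf /dim /= mul1n.
rewrite /congr_dim; suff <- : (q @: congr_tangent A)%VS = fullv.
  rewrite (@limg_dim_eq _ _ _ q) //; apply/eqP; rewrite -subv0; apply/subvP => Y.
  rewrite memv_cap memv_ker qE memv0 => /andP[/memv_imgP[X _ ->]].
  rewrite lfunE /= => /eqP pX; apply/eqP; apply: inj.
  apply/(all_tnthP (T := 'I_n * 'I_n) (t := in_tuple s)) => k.
  by have := congr1 (fun M : 'rV_(size s) => M 0 k) pX; rewrite !mxE => ->.
apply/eqP; rewrite eqEsubv subvf /=; apply/subvP => y _.
(* Carries the coordinates of [y] at the positions [s]; elsewhere [index] is out of range and [nth]
   yields 0. *)
pose Y : 'M[C]_n := \matrix_(i, j)
  nth 0 [seq y 0 k | k <- enum 'I_(size s)] (index (i, j) s).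
have [X XY] := surj Y.
apply/memv_imgP; exists (congr_tangent_map A X).
  by apply/memv_imgP; exists X; rewrite ?memvf ?lfunE.
rewrite qE; apply/rowP => k; rewrite mxE.
have ck x0 : nth x0 s k = c k by rewrite /c (tnth_nth x0).
have := congr1 (fun t => nth 0 t k) XY.
rewrite !(nth_map (c k)) // ck => ->.
rewrite mxE -surjective_pairing -(ck (c k)) index_uniq //.
by rewrite (nth_map k) ?size_enum_ord // nth_ord_enum.
Qed.


Let o0 : 'I_3 := @Ordinal 3 0 isT.
Let o1 : 'I_3 := @Ordinal 3 1 isT.
Let o2 : 'I_3 := @Ordinal 3 2 isT.

(** In each case the listed entries of X^T A + A X determine the others linearly, and [preimage]
    gives an X with prescribed listed entries. *)
Lemma congr_dim_canon3 (v : canon3 C) : admissible v ->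
  congr_dim (canon3_mx v) = canon3_dim v.
Proof.
Ltac combine1 k :=
  match goal with H : ?x = ?z |- _ = ?z =>
    solve [transitivity (k * x); [ring | by rewrite H mulr0]] end.
Ltac combine2 k k' :=
  match goal with H : ?x = ?z, H' : ?y = ?z |- _ = ?z =>
    solve [transitivity (k * x + k' * y);
           [ring | by rewrite H H' !mulr0 addr0]] end.
Ltac dim_by s :=
  rewrite canon3E (@congr_dim_coordinates _ _ s) //;
  [move=> X; have [a [b [c [d [e [f [g [h [i ->]]]]]]]]] := entries3P X;
   rewrite /congr_tangent_map /= !entries3E ?simp01 ?mxE /=;
   repeat (case/andP => /eqP ?); move=> _;
   rewrite mx0_entries3; congr entries3; try by [|ring|eq_from_eqs]
  |move=> Y; have [a [b [c [d [e [f [g [h [i ->]]]]]]]]] := entries3P Y;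
   rewrite /congr_tangent_map /=].
Ltac preimage X :=
  exists X; rewrite ?entries3E ?simp01 ?mxE /= ?simp01;
  repeat apply: (congr2 cons); try by [|field].
case: v => [|||| l ||||||m|] va.
- dim_by ([::] : seq ('I_3 * 'I_3)).
  preimage (E 0 0 0 0 0 0 0 0 0).
- dim_by [:: (o0, o1); (o0, o2); (o1, o2)].
  preimage (E b 0 (- f) 0 0 c 0 0 0).
- dim_by [:: (o0, o0); (o0, o1); (o0, o2)].
  preimage (E (a / 2) b c 0 0 0 0 0 0).
- dim_by [:: (o0, o1); (o1, o0); (o1, o1); (o0, o2); (o1, o2)].
  (* Entry (3,2) is minus entry (2,3) minus twice entry (1,3). *)
  combine2 (-1 : C) (-2 : C).
  preimage
    (E ((d - b) / 2 - e / 2) 0 (f + c) ((d + b) / 2) (e / 2) (- c) 0 0 0).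
- use_admissible va.
  dim_by [:: (o0, o0); (o0, o1); (o1, o1); (o0, o2); (o2, o1)].
  (* Three unlisted entries are [l] times their transposes; as [l] may be 0, the listed positions
     cannot be traded for these. *)
  1-3: combine1 l.
  preimage (E b (e / (1 + l)) h (a / (1 + l)) 0 c 0 0 0).
  1-2: by field; exact/eqP.
- dim_by [:: (o0, o0); (o0, o1); (o1, o1); (o0, o2); (o1, o2)].
  preimage (E (a / 2) b c 0 (e / 2) f 0 0 0).
- dim_by [:: (o0, o1); (o0, o2); (o2, o0); (o1, o2); (o2, o1); (o2, o2)].
  preimage (E b 0 ((h - f) / 2) 0 0 ((c - g) / 2) ((c + g) / 2) ((h + f) / 2)
    (i / 2)).
- dim_by [:: (o0, o0); (o0, o1); (o1, o1); (o0, o2); (o1, o2); (o2, o2)].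
  preimage (E (a / 2) b c 0 (e / 2) f 0 0 (i / 2)).
- dim_by [:: (o0, o0); (o0, o1); (o1, o0); (o1, o1);
    (o1, o2); (o2, o1); (o2, o2)].
  (* Entry (1,3) is the sum of entries (1,1) and (3,3). *)
  combine2 (1 : C) (1 : C).
  preimage (E b e h a 0 i d 0 f).
- dim_by [:: (o0, o1); (o0, o2); (o1, o0); (o1, o1);
    (o1, o2); (o2, o0); (o2, o1); (o2, o2)].
  preimage (E ((d - b) / 2 - e / 2) 0 ((f - h) / 2) ((d + b) / 2) (e / 2)
    ((g - c) / 2) ((c + g) / 2) ((f + h) / 2 - (g - c) / 2) (i / 2)).
- use_admissible va.
  dim_by [:: (o0, o0); (o0, o1); (o1, o1); (o0, o2); (o1, o2);
    (o2, o0); (o2, o1); (o2, o2)].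
  combine1 m.
  (* Each of the pairs (1,3), (3,1) and (2,3), (3,2) is a linear system solved by subtraction, which
     divides by [m - 1]. *)
  preimage (E b (e / (1 + m)) ((f - h) / (m - 1)) (a / (1 + m)) 0
    ((g - c) / (m - 1)) (c - (g - c) / (m - 1)) (h - (f - h) / (m - 1)) (i / 2)).
  1-6: by field; exact/eqP.
- dim_by [:: (o0, o0); (o0, o1); (o0, o2); (o1, o1); (o1, o2);
    (o2, o0); (o2, o1); (o2, o2)].
  (* Entry (2,1) is entry (1,2) minus entry (1,1). *)
  combine2 (1 : C) (-1 : C).
  preimage (E (c + (g - c) / 2 - ((h - f) / 2 + e / 2)) ((f + h) / 2) (i / 2)
    ((g - c) / 2) (- (e / 2)) 0 (a / 2) (b + (g - c) / 2 - a / 2) ((h - f) / 2 + e / 2)).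
Qed.

End TangentDimension.

Theorem theorem2p3 (R : realType) :
  [/\ forall A : 'M[complexes R]_3,
        exists2 v, admissible v & congruent A (canon3_mx v),
      forall v w : canon3 (complexes R), admissible v -> admissible w ->
        (congruent (canon3_mx v) (canon3_mx w) <-> canon3_same v w),
      is_closure_graph (@class_arrow3 (complexes R)) &
      forall (v : canon3 (complexes R)) (A : 'M[complexes R]_3),
        admissible v -> congruent (canon3_mx v) A ->
        congr_dim A = canon3_dim v].
Proof.
split; first exact: congruent_canon3.
- move=> v w va wa; split; last exact: canon3_same_congruent.
  by move/congr_class_eq; exact: canon3_class_inj.
- split; [exact: class_arrow3P|exact: class_arrow3_pathP].
- by move=> v A va /congr_dim_congruent <-; exact: congr_dim_canon3.
Qed.
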